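(* Let $b$ be a geometric structure on a manifold $M$, $\{\cdot,\cdot\}_{b}$ the associated $b$-bracket, and $F\in\mathcal{C}^{\infty}(M,\mathbb{R})$. Then the left-Leibniz vector field generated by $F$ (i.e., the derivation $G\in\mathcal{C}^{\infty}(M,\mathbb{R})\mapsto \{G,F\}_{b}\in\mathcal{C}^{\infty}(M,\mathbb{R})$) coincides with $\nabla_{b}^{L}F$, while the right-Leibniz vector field generated by $F$ (i.e., the derivation $G\in\mathcal{C}^{\infty}(M,\mathbb{R})\mapsto \{F,G\}_{b}\in\mathcal{C}^{\infty}(M,\mathbb{R})$) coincides with $\nabla_{b}^{R}F$.
   Context: All manifolds are connected, Hausdorff, paracompact and smooth; all maps are smooth. A geometric structure on a manifold $M$ is a non-degenerate $(0,2)$-tensor field $b:\mathfrak{X}(M)\times\mathfrak{X}(M)\to\mathcal{C}^{\infty}(M,\mathbb{R})$ (no symmetry is assumed). For $F\in\mathcal{C}^{\infty}(M,\mathbb{R})$, the left-gradient $\nabla^{L}_{b}F$ and the right-gradient $\nabla^{R}_{b}F$ are the vector fields uniquely defined by $b(\nabla^{L}_{b}F,X)=\mathrm{d}F\cdot X$ and $b(X,\nabla^{R}_{b}F)=\mathrm{d}F\cdot X$ for all $X\in\mathfrak{X}(M)$. The $b$-bracket is $\{F,G\}_b:=b(\nabla_{b}^{L}F,\nabla_{b}^{L}G)=b(\nabla_{b}^{R}F,\nabla_{b}^{R}G)$ (the two expressions agree); it is $\mathbb{R}$-bilinear and a derivation in each entry. Vector fields are identified with derivations of $\mathcal{C}^{\infty}(M,\mathbb{R})$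 via $X(G)=\mathrm{d}G\cdot X$. *)

(* Defs.v *)
From HB Require Import structures.
From mathcomp Require Import all_boot all_order all_algebra.
From mathcomp Require Import all_classical all_reals all_analysis.

Set Implicit Arguments.
Unset Strict Implicit.
Unset Printing Implicit Defensive.

Import Order.TTheory GRing.Theory Num.Theory.
Import numFieldNormedType.Exports.

Local Open Scope classical_set_scope.
Local Open Scope ring_scope.

Section SmoothMaps.
Context {R : realType} {n : nat} {V : normedModType R}.

(* Only used for open D, where differentiability and the directional
   derivatives at points of D do not depend on the values outside D. *)
Fixpoint Ck_on (k : nat) (D : set 'rV[R]_n) (f : 'rV[R]_n -> V) : Prop :=
  if k is k'.+1 then
    (forall x, D x -> differentiable f x) /\
    (forall v : 'rV[R]_n, Ck_on k' D (fun x => 'D_v f x))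
  else forall x, D x -> {for x, continuous f}.

Definition smooth_on (D : set 'rV[R]_n) (f : 'rV[R]_n -> V) : Prop :=
  forall k, Ck_on k D f.

End SmoothMaps.

Definition paracompact (T : topologicalType) : Prop :=
  forall U : set (set T), (forall A, U A -> open A) ->
    \bigcup_(A in U) A = [set: T] ->
  exists V : set (set T),
    [/\ forall B, V B -> open B,
        \bigcup_(B in V) B = [set: T],
        forall B, V B -> exists2 A, U A & B `<=` A &
        forall x : T, exists2 N, nbhs x N &
          finite_set [set B | V B /\ B `&` N !=set0]].

(* The maps chart_fun and chart_inv are total; their values outside chart_dom
   and outside its image are irrelevant. *)
Record chart (R : realType) (n : nat) (T : topologicalType) := Chart {
  chart_dom : set T ;
  chart_fun :> T -> 'rV[R]_n ;
  chart_inv : 'rV[R]_n -> T ;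
  chart_dom_open : open chart_dom ;
  chart_im_open : open (chart_fun @` chart_dom) ;
  chart_funK : {in chart_dom, cancel chart_fun chart_inv} ;
  chart_fun_continuous : {in chart_dom, continuous chart_fun} ;
  chart_inv_continuous : {in chart_fun @` chart_dom, continuous chart_inv}
}.

Definition chart_im (R : realType) (n : nat) (T : topologicalType)
  (c : chart R n T) : set 'rV[R]_n := c @` chart_dom c.

Definition transition (R : realType) (n : nat) (T : topologicalType)
  (c c' : chart R n T) : 'rV[R]_n -> 'rV[R]_n := c' \o chart_inv c.

Record manifold (R : realType) (n : nat) := Manifold {
  points :> topologicalType ;
  points_connected : connected [set: points] ;
  points_hausdorff : hausdorff_space points ;
  points_paracompact : paracompact points ;
  atlas : set (chart R n points) ;
  atlas_cover : forall x : points, exists c, atlas c /\ chart_dom c x ;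
  atlas_compatible : forall c c', atlas c -> atlas c' ->
    smooth_on (c @` (chart_dom c `&` chart_dom c')) (transition c c')
}.

Section Calculus.
Context {R : realType} {n : nat} (M : manifold R n).

Definition Cinfty : set (M -> R) :=
  [set F : M -> R | forall c : chart R n M, atlas c ->
     smooth_on (V := R^o) (chart_im c) (F \o chart_inv c)].

(* A chart around each point, chosen once and for all. A tangent vector at x is
   represented by its coordinates in chart_at x, so that each T_xM is 'rV_n;
   the coordinates in the other charts are obtained through the differentials
   of the transition maps. *)
Definition chart_at (x : M) : chart R n M := sval (cid (atlas_cover x)).

Definition tangent (x : M) : Type := 'rV[R]_n.

(* Coordinates in c of a tangent vector at x, and the converse operation. *)
Definition to_chart (c : chart R n M) (x : M) (v : tangent x) : 'rV[R]_n :=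
  'd (transition (chart_at x) c) (chart_at x x) v.

Definition of_chart (c : chart R n M) (x : M) (v : 'rV[R]_n) : tangent x :=
  'd (transition c (chart_at x)) (c x) v.

Definition vector_fields : set (forall x, tangent x) :=
  [set X : forall x, tangent x | forall c : chart R n M, atlas c ->
     smooth_on (chart_im c)
       (fun y => to_chart c (X (chart_inv c y)))].

(* The derivation dG . X of C^oo(M) induced by X. *)
Definition dact (X : forall x, tangent x) (G : M -> R) : M -> R :=
  fun x => 'd (G \o chart_inv (chart_at x) : _ -> R^o) (chart_at x x) (X x).

Definition is_derivation (D : (M -> R) -> (M -> R)) : Prop :=
  [/\ forall G, Cinfty G -> Cinfty (D G),
      forall (a : R) G H, Cinfty G -> Cinfty H ->
        D (fun x => a * G x + H x) = (fun x => a * D G x + D H x) &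
      forall G H, Cinfty G -> Cinfty H ->
        D (fun x => G x * H x) = (fun x => D G x * H x + G x * D H x)].

Record geometric_structure := GeometricStructure {
  gform : forall x, tangent x -> tangent x -> R ;
  gform_linearl : forall x (v : 'rV[R]_n), scalar (fun u => @gform x u v) ;
  gform_linearr : forall x (u : 'rV[R]_n), scalar (fun v => @gform x u v) ;
  gform_smooth : forall c (i j : 'I_n), atlas c ->
    smooth_on (chart_im c)
      (fun y => let x := chart_inv c y in
         gform (of_chart c x (delta_mx 0 i)) (of_chart c x (delta_mx 0 j))
         : R^o) ;
  gform_nondegl : forall x (u : 'rV[R]_n),
    (forall v, @gform x u v = 0) -> u = 0 ;
  gform_nondegr : forall x (v : 'rV[R]_n),
    (forall u, @gform x u v = 0) -> v = 0
}.

Definition geval (b : geometric_structure) (X Y : forall x, tangent x) : M -> R :=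
  fun x => gform b (X x) (Y x).

Definition is_left_gradient (b : geometric_structure) (F : M -> R)
    (Z : forall x, tangent x) : Prop :=
  vector_fields Z /\ forall X, vector_fields X -> geval b Z X = dact X F.

Definition is_right_gradient (b : geometric_structure) (F : M -> R)
    (Z : forall x, tangent x) : Prop :=
  vector_fields Z /\ forall X, vector_fields X -> geval b X Z = dact X F.

(* The default value 0 of xget is irrelevant: for F in Cinfty the gradients
   exist, by non-degeneracy. *)
Definition left_gradient (b : geometric_structure) (F : M -> R)
    : forall x, tangent x :=
  xget (0 : M -> 'rV[R]_n) [set Z | is_left_gradient b F Z].

Definition right_gradient (b : geometric_structure) (F : M -> R)
    : forall x, tangent x :=
  xget (0 : M -> 'rV[R]_n) [set Z | is_right_gradient b F Z].

Definition bracket (b : geometric_structure) (F G : M -> R) : M -> R :=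
  geval b (left_gradient b F) (left_gradient b G).

Definition left_leibniz (b : geometric_structure) (F : M -> R)
  : (M -> R) -> (M -> R) := fun G => bracket b G F.

Definition right_leibniz (b : geometric_structure) (F : M -> R)
  : (M -> R) -> (M -> R) := fun G => bracket b F G.

End Calculus.

(* Main.v *)
From HB Require Import structures.
Require Import Defs.
From mathcomp Require Import all_boot all_order all_algebra perm.
From mathcomp Require Import all_classical all_reals all_analysis.

(** The two formulas are formal consequences of the existence of gradients. Once
    the left gradient of G is known to be a vector field that represents dG,
    {G, F} = b(grad^L G, grad^L F) = dG . grad^L F, while
    {F, G} = b(grad^L F, grad^L G) = dF . grad^L G
           = b(grad^L G, grad^R F) = dG . grad^R F,
    where the left gradient of G is the test field both times.

    Existence is [left_gradient_exists]. Pointwise, a nondegenerate bilinear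
    form represents every linear form ([nondeg_represents]). That the pointwise
    solution is smooth is seen in a chart c: if A is the Gram matrix of b in the
    coordinate frame, the coordinate row z of the gradient satisfies z A = p,
    with p the row of partial derivatives of F, so z = p A^-1, and by Cramer's
    formula A^-1 is smooth where A is ([Ck_on_invmx]). Right gradients are left
    gradients of the structure with its two arguments exchanged.

    A tangent vector at x is stored through its coordinates in one preferred
    chart at x, so passing to another chart is the chain rule for transition
    maps ([diff_chart_change]). It makes of_chart and to_chart mutually inverse
    and gives the coordinate formula of [dact_chartE], from which vector fields
    act as derivations of the algebra of smooth functions. *)

Set Implicit Arguments.
Unset Strict Implicit.
Unset Printing Implicit Defensive.

Import Order.TTheory GRing.Theory Num.Theory.
Import numFieldNormedType.Exports.

Local Open Scope classical_set_scope.
Local Open Scope ring_scope.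

(** * Differentials are local *)

Lemma near_eq0_diff (R : realType) (V W : normedModType R) (h : V -> W)
    (x : V) :
  (\near x, h x = 0) -> differentiable h x /\ forall v, 'd h x v = 0.
Proof.
move=> h0; have hx0 : h x = 0 by exact: nbhs_singleton h0.
have hE : h \o shift x = cst (h x) + (\0 : V -> W) +o_ 0 id.
  apply/eqaddoP => _/posnumP[e]; rewrite hx0.
  move: h0; rewrite (near_shift 0) subr0; apply: filterS => y /= hy.
  by rewrite !fctE/= hy addr0 subrr normr0 mulr_ge0.
pose z : {linear V -> W} := \0.
have z0 : continuous z by exact: cst_continuous.
have dh : 'd h x = z :> (V -> W) by exact: (diff_unique z0 hE).
split; last by move=> v; rewrite dh.
by apply/diff_locallyP; rewrite dh; split.
Qed.

(** By additivity it suffices to treat the difference of the two functions,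
    which vanishes near x. *)
Lemma near_eq_diff (R : realType) (V W : normedModType R) (f g : V -> W)
    (x : V) :
  (\near x, f x = g x) -> differentiable f x ->
  differentiable g x /\ forall v, 'd g x v = 'd f x v.
Proof.
move=> fg df.
have [h [hE h0]] : exists h, g = f + h /\ \near x, h x = 0.
  exists (g - f); split; first by rewrite addrC subrK.
  by apply: filterS fg => y fgy; rewrite !fctE fgy subrr.
have [dh h'0] := near_eq0_diff h0.
rewrite hE; split; first exact: differentiableD.
move=> v.
have e := congr1 (@^~ v) (diffD df dh).
apply: (eq_trans e).
have -> : ('d f x \+ 'd h x) v = 'd f x v + 'd h x v by [].
by rewrite h'0 addr0.
Qed.

(** * Functions of class C^k on an open set *)

Section Ck.
Context {R : realType} {n : nat}.
Implicit Types (D : set 'rV[R]_n) (k : nat).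

(** Ck_on speaks of total functions, but on an open set their values elsewhere
    do not matter. This is what allows the derivative of a product or of an
    inverse to be replaced by its Leibniz formula in the inductions below. *)
Lemma Ck_on_ext (V : normedModType R) k D (f g : 'rV[R]_n -> V) :
  open D -> (forall x, D x -> f x = g x) -> Ck_on k D f -> Ck_on k D g.
Proof.
move=> oD.
have near_eq (f' g' : 'rV[R]_n -> V) (e : forall x, D x -> f' x = g' x) x :
    D x -> \near x, f' x = g' x.
  by move=> Dx; apply: filterS (open_nbhs_nbhs (conj oD Dx)).
elim: k f g => [|k IH] f g fg /=; have nfg := near_eq _ _ fg.
  move=> Cf x Dx; have := Cf x Dx.
  rewrite /prop_for /continuous_at -(fg x Dx).
  by move=> fx; apply: cvg_trans fx; exact: (near_eq_cvg (nfg x Dx)).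
move=> [df Cf]; split=> [x Dx|v].
  by have [] := near_eq_diff (nfg x Dx) (df x Dx).
apply: IH (Cf v) => x Dx; have [dg e] := near_eq_diff (nfg x Dx) (df x Dx).
by rewrite (deriveE _ dg) e (deriveE _ (df x Dx)).
Qed.

Lemma Ck_on_pred (V : normedModType R) k D (f : 'rV[R]_n -> V) :
  Ck_on k.+1 D f -> Ck_on k D f.
Proof.
elim: k f => [|k IH] f [df Cf].
  by move=> x Dx; apply: differentiable_continuous; exact: df.
by split=> // v; apply: IH.
Qed.

Lemma Ck_on_linear (V W : normedModType R) (L : {linear V -> W}) k D
    (f : 'rV[R]_n -> V) :
  continuous L -> open D -> Ck_on k D f -> Ck_on k D (L \o f).
Proof.
move=> cL oD; elim: k f => [|k IH] f /=.
  by move=> Cf x Dx; apply: continuous_comp; [exact: Cf|exact: cL].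
move=> [df Cf]; split=> [x Dx|v].
  apply: differentiable_comp; first exact: df.
  exact: linear_differentiable.
apply: Ck_on_ext (IH _ (Cf v)) => // x Dx /=.
have dfx := df x Dx.
have dL : differentiable L (f x) by exact: linear_differentiable.
have dLf : differentiable (L \o f) x by exact: differentiable_comp.
rewrite (deriveE _ dfx) (deriveE _ dLf).
have e := congr1 (@^~ v) (diff_comp dfx dL); apply/esym/(eq_trans e).
by rewrite (diff_lin _ cL).

Qed.

Lemma Ck_onD (V : normedModType R) k D (f g : 'rV[R]_n -> V) :
  open D -> Ck_on k D f -> Ck_on k D g -> Ck_on k D (f + g).
Proof.
move=> oD; elim: k f g => [|k IH] f g /=.
  by move=> Cf Cg x Dx; apply: continuousD; [exact: Cf|exact: Cg].
move=> [df Cf] [dg Cg]; split=> [x Dx|v].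
  by apply: differentiableD; [exact: df|exact: dg].
apply: Ck_on_ext (IH _ _ (Cf v) (Cg v)) => // x Dx.
by rewrite deriveD//; apply: diff_derivable; [exact: df|exact: dg].
Qed.

Lemma Ck_on_cst (V : normedModType R) k D (a : V) : Ck_on k D (cst a).
Proof.
elim: k a => [|k IH] a /=; first by move=> x _; exact: cst_continuous.
split=> [x _|v]; first exact: differentiable_cst.
have -> : (fun x : 'rV[R]_n => 'D_v (cst a) x) = cst 0.
  by apply/funext => x; rewrite derive_cst.
exact: IH.
Qed.

(** In the inductive step the derivative of f g involves f and g themselves,
    which are only needed at the lower class k; hence [Ck_on_pred]. *)
Lemma Ck_onM k D (f g : 'rV[R]_n -> R^o) :
  open D -> Ck_on k D f -> Ck_on k D g ->
  Ck_on k D (fun x => f x * g x : R^o).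
Proof.
move=> oD; elim: k f g => [|k IH] f g.
  by move=> /= Cf Cg x Dx; apply: (@continuousM R); [exact: Cf|exact: Cg].
move=> CSf CSg; have [df Cf] := CSf; have [dg Cg] := CSg.
split=> [x Dx|v].
  by apply: (@differentiableM R _ f g); [exact: df|exact: dg].
have : Ck_on k D ((fun x => f x * 'D_v g x : R^o) +
                  (fun x => g x * 'D_v f x : R^o)).
  apply: (Ck_onD oD).
    exact: (IH _ _ (Ck_on_pred CSf) (Cg v)).
  exact: (IH _ _ (Ck_on_pred CSg) (Cf v)).
apply: Ck_on_ext => // x Dx.
rewrite [RHS](@deriveM R _ f g)//.
  by apply: diff_derivable; exact: df.
by apply: diff_derivable; exact: dg.
Qed.

Lemma Ck_onV k D (f : 'rV[R]_n -> R^o) :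
  open D -> (forall x, D x -> f x != 0) -> Ck_on k D f ->
  Ck_on k D (fun x => (f x)^-1 : R^o).
Proof.
move=> oD f0; elim: k => [|k IH].
  by move=> /= Cf x Dx; apply: (@continuousV R); [exact: f0|exact: Cf].
move=> CSf; have [df Cf] := CSf.
split=> [x Dx|v].
  exact: (@differentiableV R _ f x (df x Dx) (f0 x Dx)).
have CV := IH (Ck_on_pred CSf).
have : Ck_on k D
    (fun x => (cst (-1) x * ((f x)^-1 * (f x)^-1)) * 'D_v f x : R^o).
  have C1 : Ck_on k D (cst (-1) : 'rV[R]_n -> R^o) by exact: Ck_on_cst.
  exact: (Ck_onM oD (Ck_onM oD C1 (Ck_onM oD CV CV)) (Cf v)).
apply: Ck_on_ext => // x Dx /=.
rewrite [RHS](@deriveV R _ f) ?f0//; last by apply: diff_derivable; exact: df.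
by rewrite mulN1r -expr2 exprVn.
Qed.

End Ck.

(** * Matrices and rows of C^k functions *)

Section CkMatrix.
Context {R : realType} {n : nat}.
Implicit Types (D : set 'rV[R]_n) (k : nat).

Lemma Ck_on_sum (V : normedModType R) (I : Type) (r : seq I) k D
    (f : I -> 'rV[R]_n -> V) :
  open D -> (forall i, Ck_on k D (f i)) ->
  Ck_on k D (fun x => \sum_(i <- r) f i x).
Proof.
move=> oD Cf; elim: r => [|i r IH].
  have -> : (fun x => \sum_(i <- [::]) f i x) = cst 0.
    by apply/funext => x; rewrite big_nil.
  exact: Ck_on_cst.
have -> : (fun x => \sum_(j <- i :: r) f j x) =
          f i + (fun x => \sum_(j <- r) f j x).
  by apply/funext => x; rewrite big_cons.
exact: Ck_onD.
Qed.

Lemma Ck_on_prod (I : Type) (r : seq I) k D (f : I -> 'rV[R]_n -> R^o) :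
  open D -> (forall i, Ck_on k D (f i)) ->
  Ck_on k D (fun x => \prod_(i <- r) f i x : R^o).
Proof.
move=> oD Cf; elim: r => [|i r IH].
  have -> : (fun x => \prod_(i <- [::]) f i x : R^o) = cst 1.
    by apply/funext => x; rewrite big_nil.
  exact: Ck_on_cst.
have -> : (fun x => \prod_(j <- i :: r) f j x : R^o) =
          (fun x => f i x * \prod_(j <- r) f j x : R^o).
  by apply/funext => x; rewrite big_cons.
exact: (Ck_onM oD (Cf i) IH).
Qed.

Lemma Ck_on_det m k D (A : 'rV[R]_n -> 'M[R]_m) :
  open D -> (forall i j, Ck_on k D (fun x => A x i j : R^o)) ->
  Ck_on k D (fun x => \det (A x) : R^o).
Proof.
move=> oD CA; rewrite /determinant.
have Cs (s : 'S_m) : Ck_on k D (fun x => (-1) ^+ s * \prod_i A x i (s i) : R^o).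
  have C1 : Ck_on k D (cst ((-1) ^+ s) : 'rV[R]_n -> R^o) by exact: Ck_on_cst.
  exact: (Ck_onM oD C1 (Ck_on_prod _ oD (fun i => CA i (s i)))).
exact: (Ck_on_sum (index_enum 'S_m) oD Cs).
Qed.

(** Cramer's formula: the entries of the inverse are cofactors divided by the
    determinant. *)
Lemma Ck_on_invmx m k D (A : 'rV[R]_n -> 'M[R]_m) i j :
  open D -> (forall x, D x -> A x \in unitmx) ->
  (forall i j, Ck_on k D (fun x => A x i j : R^o)) ->
  Ck_on k D (fun x => invmx (A x) i j : R^o).
Proof.
move=> oD uA CA.
have d0 x : D x -> \det (A x) != 0 by move=> /uA; rewrite unitmxE unitfE.
have Cadj : Ck_on k D (fun x => \adj (A x) i j : R^o).
  have -> : (fun x => \adj (A x) i j : R^o) =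
      (fun x => cst ((-1) ^+ (j + i)) x * \det (row' j (col' i (A x))) : R^o).
    by apply/funext => x; rewrite mxE /cofactor.
  have Cs : Ck_on k D (cst ((-1) ^+ (j + i)) : 'rV[R]_n -> R^o).
    exact: Ck_on_cst.
  apply: (Ck_onM oD Cs); apply: Ck_on_det => // i' j'.
  have -> : (fun x => row' j (col' i (A x)) i' j' : R^o) =
      (fun x => A x (lift j i') (lift i j')).
    by apply/funext => x; rewrite !mxE.
  exact: CA.
apply: Ck_on_ext (Ck_onM oD (Ck_onV oD d0 (Ck_on_det oD CA)) Cadj) => // x Dx.
by rewrite /invmx (uA x Dx) [RHS]mxE.
Qed.

(** Both directions compose with linear maps: the coordinate functionals, and
    the inclusions of the coordinate lines. *)
Lemma Ck_on_row m k D (f : 'rV[R]_n -> 'rV[R]_m) :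
  open D ->
  Ck_on k D f <-> forall i, Ck_on k D (fun x => f x 0 i : R^o).
Proof.
move=> oD; split=> [Cf i|Cf].
  pose L (u : 'rV[R]_m) : R^o := u 0 i.
  have lL : linear L by move=> a u v; rewrite /L !mxE.
  pose L' := GRing.isLinear.Build R _ _ _ L lL.
  pose L'' : {linear 'rV[R]_m -> R^o} := HB.pack L L'.
  apply: (@Ck_on_linear _ _ _ _ L'') => //.
  exact: coord_continuous.
have -> : f = fun x => \sum_i f x 0 i *: delta_mx 0 i.
  by apply/funext => x; exact: row_sum_delta.
apply: (Ck_on_sum _ oD) => i.
pose L (a : R^o) : 'rV[R]_m := a *: delta_mx 0 i.
have lL : linear L by move=> a u v; rewrite /L scalerDl scalerA.
pose L' := GRing.isLinear.Build R _ _ _ L lL.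
pose L'' : {linear R^o -> 'rV[R]_m} := HB.pack L L'.
apply: (@Ck_on_linear _ _ _ _ L'' k D _ _ oD (Cf i)) => x.
exact: (@scalel_continuous R).
Qed.

End CkMatrix.

(** * Nondegenerate bilinear forms *)

Section Gram.
Context {R : fieldType} {n : nat} (h : 'rV[R]_n -> 'rV[R]_n -> R).
Context (hl : forall v, scalar (h^~ v)) (hr : forall u, scalar (h u))
  (nondeg : forall u, (forall v, h u v = 0) -> u = 0).

Definition gram : 'M[R]_n := \matrix_(i, j) h (delta_mx 0 i) (delta_mx 0 j).

Lemma scalar_row_sum (l : 'rV[R]_n -> R) (u : 'rV[R]_n) : scalar l ->
  l u = \sum_i u 0 i * l (delta_mx 0 i).
Proof.
move=> sl; pose L' := GRing.isLinear.Build R _ _ *%R l sl.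
pose L'' : {scalar 'rV[R]_n} := HB.pack l L'.
rewrite {1}(row_sum_delta u) -[l]/(L'' : _ -> _) linear_sum.
by apply: eq_bigr => i _; rewrite linearZ.
Qed.

Lemma mul_gramE (u : 'rV[R]_n) j : (u *m gram) 0 j = h u (delta_mx 0 j).
Proof.
rewrite mxE (scalar_row_sum u (hl _)).
by apply: eq_bigr => i _; rewrite mxE.
Qed.

(** A row in the left kernel of the Gram matrix is left orthogonal to the
    standard basis, hence zero. *)
Lemma gram_unit : gram \in unitmx.
Proof.
rewrite -row_free_unit; apply: inj_row_free => u ug; apply: nondeg => v.
rewrite (scalar_row_sum v (hr u)) big1// => j _.
by rewrite -mul_gramE ug mxE mulr0.
Qed.

Lemma nondeg_represents (l : 'rV[R]_n -> R) : scalar l ->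
  exists u, forall v, h u v = l v.
Proof.
move=> sl; exists (\row_j l (delta_mx 0 j) *m invmx gram) => v.
rewrite (scalar_row_sum v (hr _)) (scalar_row_sum v sl).
by apply: eq_bigr => j _; rewrite -mul_gramE mulmxKV ?gram_unit// mxE.
Qed.

End Gram.

(** * Change of charts *)

Section Charts.
Context {R : realType} {n : nat} (M : manifold R n).
Implicit Types (c : chart R n M) (x : M).

Lemma atlas_chart_at x : atlas (chart_at x).
Proof. by rewrite /chart_at; case: (cid _) => c []. Qed.

Lemma chart_at_dom x : chart_dom (chart_at x) x.
Proof. by rewrite /chart_at; case: (cid _) => c []. Qed.

Lemma chart_invK c x : chart_dom c x -> chart_inv c (c x) = x.
Proof. by move=> cx; apply: chart_funK; rewrite inE. Qed.

Lemma chart_imP c x : chart_dom c x -> chart_im c (c x).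
Proof. by move=> cx; exists x. Qed.

Lemma near_chart_overlap c c' x : chart_dom c x -> chart_dom c' x ->
  \forall y \near c x, [/\ chart_dom c (chart_inv c y),
    chart_dom c' (chart_inv c y) & c (chart_inv c y) = y].
Proof.
move=> cx c'x; have imx := chart_imP cx.
have nim : \forall y \near c x, chart_im c y.
  by apply: open_nbhs_nbhs; split=> //; exact: chart_im_open.
have : \forall y \near c x, chart_dom c' (chart_inv c y).
  have cc : {for c x, continuous (chart_inv c)}.
    by apply: chart_inv_continuous; rewrite inE.
  apply: cc; rewrite chart_invK//.
  by apply: open_nbhs_nbhs; split=> //; exact: chart_dom_open.
apply: filterS2 nim => y [z cz <-]; rewrite chart_invK//.
Qed.

Lemma transition_differentiable c c' x : atlas c -> atlas c' ->
  chart_dom c x -> chart_dom c' x -> differentiable (transition c c') (c x).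
Proof.
move=> ac ac' cx c'x; have [d _] := atlas_compatible ac ac' 1%N.
by apply: d; exists x.
Qed.

(** The chain rule, since f \o chart_inv c agrees near c x with the composite of
    f \o chart_inv c' and the transition map. The values of f are in an arbitrary
    normed module because f will be a scalar function as well as a chart. *)
Lemma diff_chart_change (V : normedModType R) (f : M -> V) c c' x :
  atlas c -> atlas c' -> chart_dom c x -> chart_dom c' x ->
  differentiable (f \o chart_inv c') (c' x) ->
  forall v, 'd (f \o chart_inv c) (c x) v =
            'd (f \o chart_inv c') (c' x) ('d (transition c c') (c x) v).
Proof.
move=> ac ac' cx c'x df v.
have dt := transition_differentiable ac ac' cx c'x.
have tE : transition c c' (c x) = c' x by rewrite /transition/= chart_invK.
have df' : differentiable (f \o chart_inv c') (transition c c' (c x)).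
  by rewrite tE.
have dc := differentiable_comp dt df'.
have near_eq : \forall y \near c x,
    ((f \o chart_inv c') \o transition c c') y = (f \o chart_inv c) y.
  apply: filterS (near_chart_overlap cx c'x) => y [cy c'y _].
  by rewrite /transition/= chart_invK.
apply: (eq_trans ((near_eq_diff near_eq dc).2 v)).
by apply: (eq_trans (congr1 (@^~ v) (diff_comp dt df'))); rewrite /= tE.
Qed.

Lemma diff_transition_id c x v : chart_dom c x ->
  'd (transition c c) (c x) v = v.
Proof.
move=> cx.
have near_eq : \forall y \near c x,
    (id : 'rV[R]_n -> 'rV[R]_n) y = transition c c y.
  apply: filterS (near_chart_overlap cx cx) => y [_ _ e].
  by rewrite /transition/= e.
have did : differentiable (id : 'rV[R]_n -> 'rV[R]_n) (c x) by [].
apply: (eq_trans ((near_eq_diff near_eq did).2 v)).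
by rewrite diff_val.
Qed.

(** [diff_chart_change] applied to f := c itself: its expression in its own chart
    is a transition map whose differential is the identity. *)
Lemma of_chartK c x v : atlas c -> chart_dom c x ->
  to_chart c (of_chart c x v) = v.
Proof.
move=> ac cx; rewrite -[RHS](diff_transition_id v cx).
rewrite (diff_chart_change (c' := chart_at x) (f := c))//.
- exact: atlas_chart_at.
- exact: chart_at_dom.
- apply: transition_differentiable => //; first exact: atlas_chart_at.
  exact: chart_at_dom.
Qed.

Lemma to_chartK c x (v : tangent x) : atlas c -> chart_dom c x ->
  of_chart c x (to_chart c v) = v.
Proof.
move=> ac cx; rewrite -[RHS](diff_transition_id v (chart_at_dom x)).
rewrite (diff_chart_change (c' := c) (f := chart_at x))//.
- exact: atlas_chart_at.
- exact: chart_at_dom.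
- apply: transition_differentiable => //; first exact: atlas_chart_at.
  exact: chart_at_dom.
Qed.

Lemma Cinfty_differentiable c x (G : M -> R) : Cinfty G -> atlas c ->
  chart_dom c x -> differentiable (G \o chart_inv c : _ -> R^o) (c x).
Proof.
by move=> sG ac cx; have [d _] := sG c ac 1%N; apply: d; exact: chart_imP.
Qed.

Lemma diff_of_chart c x (G : M -> R) v : Cinfty G -> atlas c ->
  chart_dom c x ->
  'd (G \o chart_inv (chart_at x) : _ -> R^o) (chart_at x x) (of_chart c x v) =
  'd (G \o chart_inv c : _ -> R^o) (c x) v.
Proof.
move=> sG ac cx.
have dG := Cinfty_differentiable sG (atlas_chart_at x) (chart_at_dom x).
exact/esym/(diff_chart_change ac (atlas_chart_at x) cx (chart_at_dom x) dG v).
Qed.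

Lemma dact_chartE c x (X : forall x, tangent x) (G : M -> R) :
  Cinfty G -> atlas c -> chart_dom c x ->
  dact X G x = \sum_i to_chart c (X x) 0 i *
    'D_(delta_mx 0 i) (G \o chart_inv c : _ -> R^o) (c x).
Proof.
move=> sG ac cx; rewrite /dact -[in LHS](to_chartK (X x) ac cx).
rewrite diff_of_chart// {1}(row_sum_delta (to_chart c (X x))) linear_sum.
apply: eq_bigr => i _; rewrite linearZ deriveE//.
exact: Cinfty_differentiable.
Qed.

End Charts.

(** * Vector fields as derivations *)

Section Derivations.
Context {R : realType} {n : nat} (M : manifold R n).
Implicit Types (c : chart R n M) (x : M) (G H : M -> R).
Implicit Types X : forall x : M, tangent x.

Lemma CinftyD G H : Cinfty G -> Cinfty H -> Cinfty (fun x => G x + H x).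
Proof.
move=> sG sH c ac k.
exact: (Ck_onD (@chart_im_open _ _ _ c) (sG c ac k) (sH c ac k)).
Qed.

Lemma CinftyM G H : Cinfty G -> Cinfty H -> Cinfty (fun x => G x * H x).
Proof.
move=> sG sH c ac k.
exact: (Ck_onM (@chart_im_open _ _ _ c) (sG c ac k) (sH c ac k)).
Qed.

Lemma Cinfty_cst (a : R) : Cinfty (fun _ : M => a).
Proof. by move=> c ac k; exact: Ck_on_cst. Qed.

(** In a chart, [dact_chartE] is a sum of products of coordinates of X with
    partial derivatives of G. *)
Lemma Cinfty_dact X G : vector_fields X -> Cinfty G -> Cinfty (dact X G).
Proof.
move=> sX sG c ac k; have oD : open (chart_im c) := @chart_im_open _ _ _ c.
pose f (i : 'I_n) (y : 'rV[R]_n) : R^o := to_chart c (X (chart_inv c y)) 0 i *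
  'D_(delta_mx 0 i) (G \o chart_inv c : _ -> R^o) y.
have Cf i : Ck_on k (chart_im c) (f i).
  have [_ DG] := sG c ac k.+1.
  exact: (Ck_onM oD ((Ck_on_row k _ oD).1 (sX c ac k) i) (DG _)).
apply: Ck_on_ext (Ck_on_sum (index_enum 'I_n) oD Cf) => // _ [x cx <-].
by rewrite /= (dact_chartE _ sG ac)// /f chart_invK.
Qed.

Lemma dact_derive X G x : Cinfty G ->
  dact X G x = 'D_(X x) (G \o chart_inv (chart_at x) : _ -> R^o) (chart_at x x).
Proof.
move=> sG; rewrite deriveE//.
exact: (Cinfty_differentiable sG (atlas_chart_at x) (chart_at_dom x)).
Qed.

Lemma Cinfty_derivable G x v : Cinfty G ->
  derivable (G \o chart_inv (chart_at x) : _ -> R^o) (chart_at x x) v.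
Proof.
move=> sG; apply: diff_derivable.
exact: (Cinfty_differentiable sG (atlas_chart_at x) (chart_at_dom x)).
Qed.

Lemma dact_is_derivation X :
  vector_fields X -> is_derivation (M := M) (dact X).
Proof.
move=> sX; split=> [G sG|a G H sG sH|G H sG sH].
- exact: Cinfty_dact.
- have saG : Cinfty (fun x => a * G x).
    by apply: CinftyM => //; exact: Cinfty_cst.
  have saGH := CinftyD saG sH.
  apply/funext => x; rewrite !dact_derive//.
  have dG := @Cinfty_derivable G x (X x) sG.
  have dH := @Cinfty_derivable H x (X x) sH.
  rewrite [LHS](deriveD _ dH); last exact: derivableZ.
  by congr (_ + _); exact: deriveZ.
- have sGH := CinftyM sG sH.
  apply/funext => x; rewrite !dact_derive//.
  have dG := @Cinfty_derivable G x (X x) sG.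
  have dH := @Cinfty_derivable H x (X x) sH.
  rewrite [LHS](deriveM dG dH)/= chart_invK; last exact: chart_at_dom.
  by rewrite addrC mulrC.
Qed.

(** The axioms of a derivation only concern the values on smooth functions,
    and these form an algebra. *)
Lemma eq_is_derivation (D D' : (M -> R) -> (M -> R)) :
  (forall G, Cinfty G -> D G = D' G) -> is_derivation D' -> is_derivation D.
Proof.
move=> e [sD aD mD]; split=> [G sG|a G H sG sH|G H sG sH].
- by rewrite e//; exact: sD.
- rewrite !e ?aD//; apply: CinftyD => //; apply: CinftyM => //.
  exact: Cinfty_cst.
- by rewrite !e ?mD//; exact: CinftyM.
Qed.

End Derivations.

(** * Existence of gradients *)

Section Gradients.
Context {R : realType} {n : nat} (M : manifold R n).
Implicit Types (c : chart R n M) (x : M) (F G H : M -> R).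
Implicit Types (b : geometric_structure M).

Definition chart_form b c x (u v : 'rV[R]_n) : R :=
  gform b (of_chart c x u) (of_chart c x v).

Lemma chart_form_linearl b c x v : scalar ((chart_form b c x)^~ v).
Proof.
move=> a u u'.
by rewrite /chart_form /of_chart linearP; exact: gform_linearl.
Qed.

Lemma chart_form_linearr b c x u : scalar (chart_form b c x u).
Proof.
move=> a v v'.
by rewrite /chart_form /of_chart linearP; exact: gform_linearr.
Qed.

Lemma chart_form_to_chart b c x (u : tangent x) (v : 'rV[R]_n) :
  atlas c -> chart_dom c x ->
  chart_form b c x (to_chart c u) v = gform b u (of_chart c x v).
Proof.
move=> ac cx.
exact: (congr1 (fun w => gform b w (of_chart c x v)) (to_chartK u ac cx)).
Qed.

Lemma chart_form_nondeg b c x : atlas c -> chart_dom c x ->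
  forall u, (forall v, chart_form b c x u v = 0) -> u = 0.
Proof.
move=> ac cx u hu; rewrite -(of_chartK u ac cx).
suff -> : of_chart c x u = 0 by rewrite /to_chart linear0.
apply: (@gform_nondegl _ _ _ b) => v.
by have := hu (to_chart c (v : tangent x)); rewrite /chart_form to_chartK.
Qed.

(** The coordinates of the pointwise solution Z in any chart are p A^-1, where A
    is the Gram matrix of b and p the row of partial derivatives of F. *)
Lemma left_gradient_exists b F : Cinfty F -> exists Z, is_left_gradient b F Z.
Proof.
move=> sF.
pose dF x : 'rV[R]_n -> R :=
  'd (F \o chart_inv (chart_at x) : _ -> R^o) (chart_at x x).
have repr x : exists u : 'rV[R]_n, forall v, @gform _ _ _ b x u v = dF x v.
  apply: nondeg_represents.
  - exact: (@gform_linearl _ _ _ b).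
  - exact: (@gform_linearr _ _ _ b).
  - exact: (@gform_nondegl _ _ _ b).
  - by move=> a u v; rewrite /dF linearP.
have {repr}[Z' ZE] := choice repr.
(* tangent x hides x after unfolding, so the type of Z must carry it: to_chart
   reads the base point off the type of the vector *)
pose Z : forall x : M, tangent x := Z'.
exists Z; split=> [|X sX]; last by apply/funext => x; exact: ZE.
move=> c ac k; have oD : open (chart_im c) := @chart_im_open _ _ _ c.
pose A y := gram (chart_form b c (chart_inv c y)).
have uA y : chart_im c y -> A y \in unitmx.
  move=> [x cx <-]; rewrite /A chart_invK//; apply: gram_unit.
  - exact: chart_form_linearl.
  - exact: chart_form_linearr.
  - exact: chart_form_nondeg.
have CA i j : Ck_on k (chart_im c) (fun y => A y i j : R^o).
  apply: Ck_on_ext (gform_smooth b i j ac k) => // y _.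
  by rewrite mxE.
pose p (j : 'I_n) (y : 'rV[R]_n) : R^o :=
  'D_(delta_mx 0 j) (F \o chart_inv c : _ -> R^o) y.
have Cp j : Ck_on k (chart_im c) (p j) by have [_] := sF c ac k.+1; apply.
apply/(Ck_on_row k _ oD) => i.
have Cpi j := Ck_onM oD (Cp j) (Ck_on_invmx j i oD uA CA).
apply: Ck_on_ext (Ck_on_sum (index_enum 'I_n) oD Cpi) => // _ [x cx <-].
have coordZ j : (@to_chart _ _ _ c x (Z x) *m A (c x)) 0 j = p j (c x).
  rewrite /A chart_invK// mul_gramE; last exact: chart_form_linearl.
  apply: (eq_trans (chart_form_to_chart _ _ _ ac cx)).
  apply: (eq_trans (ZE x _)); apply: (eq_trans (diff_of_chart _ sF ac cx)).
  by apply/esym/deriveE; exact: Cinfty_differentiable.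
rewrite [in RHS]chart_invK//.
rewrite -[in RHS](mulmxK (uA _ (chart_imP cx)) (to_chart (x := x) c (Z x))).
by rewrite [RHS]mxE; apply: eq_bigr => j _; rewrite coordZ.
Qed.

Lemma left_gradientP b F : Cinfty F -> is_left_gradient b F (left_gradient b F).
Proof.
move=> sF; have [Z hZ] := left_gradient_exists b sF.
by apply: (@xgetPex _ _ [set Z | is_left_gradient b F Z]); exists Z.
Qed.

(** The right gradients of b are, by definition, the left gradients of this
    structure. *)
Definition flip_structure b : geometric_structure M :=
  {| gform := fun x u v => gform b v u ;
     gform_linearl := @gform_linearr _ _ _ b ;
     gform_linearr := @gform_linearl _ _ _ b ;
     gform_smooth := fun c i j => @gform_smooth _ _ _ b c j i ;
     gform_nondegl := @gform_nondegr _ _ _ b ;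
     gform_nondegr := @gform_nondegl _ _ _ b |}.

Lemma right_gradientP b F :
  Cinfty F -> is_right_gradient b F (right_gradient b F).
Proof.
move=> sF; have [Z hZ] := left_gradient_exists (flip_structure b) sF.
by apply: (@xgetPex _ _ [set Z | is_right_gradient b F Z]); exists Z.
Qed.

End Gradients.

(** * Leibniz vector fields *)

Theorem proposition3p9 (R : realType) (n : nat) (M : manifold R n)
    (b : geometric_structure M) (F : M -> R) (hF : Cinfty F) :
  (is_derivation (left_leibniz b F) /\
   forall G : M -> R, Cinfty G ->
     left_leibniz b F G = dact (left_gradient b F) G) /\
  (is_derivation (right_leibniz b F) /\
   forall G : M -> R, Cinfty G ->
     right_leibniz b F G = dact (right_gradient b F) G).
Proof.
have [sL _] := left_gradientP b hF.
have [sR FR] := right_gradientP b hF.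
have leftE G : Cinfty G -> left_leibniz b F G = dact (left_gradient b F) G.
  by move=> sG; have [_ GL] := left_gradientP b sG; exact: GL.
have rightE G : Cinfty G -> right_leibniz b F G = dact (right_gradient b F) G.
  move=> sG; have [sLG GL] := left_gradientP b sG.
  have [_ FL] := left_gradientP b hF.
  exact: (eq_trans (FL _ sLG) (eq_trans (esym (FR _ sLG)) (GL _ sR))).
split; split=> //; apply: eq_is_derivation; [exact: leftE| |exact: rightE|];
  exact: dact_is_derivation.
Qed.
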